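(* Let $m \geq 4$ be an even integer and let $T$ be a Salem polynomial of degree $m$ having simple roots and such that $T(1)\neq 0$ and $T(-1) \neq 0$. Let $P$ and $P^{\dagger}$ be two generalized Garsia polynomials of degree $m$ over $T$ such that $P(0) = +\mathrm{M}(P)$ and $P^{\dagger}(0) = +\mathrm{M}(P^{\dagger})$. Assume that $P(0) + P^{\dagger}(0) - 1$ is a prime number. Then $P + P^{\dagger} - T$ is a generalized Garsia polynomial of degree $m$ and Mahler measure equal to $\mathrm{M}(P) + \mathrm{M}(P^{\dagger}) - 1$.
   Context: For a polynomial $P$ of degree $n$, $P^{*}(z) = z^{n} P(1/z)$; $P$ is reciprocal if $P^*=P$. An expansive polynomial is a polynomial with real coefficients, of degree $\geq 1$, all of whose complex roots have modulus strictly greater than $1$. The Mahler measure of $P(X) = a_0 \prod_{j=1}^n (X-\alpha_j)$ is $\mathrm{M}(P) = |a_0| \prod_{j=1}^n \max\{1,|\alpha_j|\}$. A generalized Garsia polynomial is a monic irreducible expansive polynomial $P$ with integer coefficients such that $\mathrm{M}(P) \geq 2$. A Salem polynomial is a monic reciprocal polynomial with integer coefficients having exactly one zero (of multiplicity $1$) of modulus $>1$, this zero being a real number $>1$, and having at least one zero on the unit circle. A polynomial $P$ of degree $m$ with positive constant term is said to be ''over $T$'' if $(z-1)T(z) = zP(z) - P^{*}(z)$. *)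

(* Defs.v *)
From HB Require Import structures.
From mathcomp Require Import all_boot all_order all_algebra.
From mathcomp Require Import reals complex.
Set Implicit Arguments.
Unset Strict Implicit.
Unset Printing Implicit Defensive.
Import Order.TTheory GRing.Theory Num.Theory.
Local Open Scope ring_scope.

(* The complex numbers are [R[i]] with [R : realType].  In the partial order of
   [R[i]], [x <= y] means that [y - x] is a nonnegative real, so comparisons
   between moduli (which are real) are the usual ones. *)

(* P^*(z) = z^n P(1/z) with n the degree of P, see [horner_recip]. *)
Definition recip (A : nzRingType) (p : {poly A}) : {poly A} :=
  \poly_(i < size p) p`_((size p).-1 - i).

Lemma horner_recip (F : fieldType) (p : {poly F}) (x : F) :
  x != 0 -> (recip p).[x] = x ^+ (size p).-1 * p.[x^-1].
Proof.
move=> x0; rewrite horner_poly horner_coef mulr_sumr (reindex_inj rev_ord_inj).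
apply: eq_bigr => i _; have lti := ltn_ord i.
have le_i : (i <= (size p).-1)%N by rewrite -ltnS (ltn_predK lti).
have -> : (rev_ord i = (size p).-1 - i :> nat)%N.
  by rewrite /= -{1}(ltn_predK lti) subSS.
rewrite subKn // mulrCA; congr (_ * _).
by rewrite exprVn -expfB_cond // (negPf x0).
Qed.

Definition reciprocal (A : nzRingType) (p : {poly A}) : Prop := recip p = p.

Definition poly_over (A : numDomainType) (T P : {poly A}) : Prop :=
  0 < P.[0] /\ ('X - 1) * T = 'X * P - recip P.

Section Definitions.
Variable R : realType.

Definition expansive (p : {poly R}) : Prop :=
  (1 < size p)%N /\
  forall z : R[i], root (map_poly (real_complex R) p) z -> 1 < `|z|.

(* The roots, with multiplicity, of a nonzero complex polynomial. *)
Definition croots (p : {poly R[i]}) : seq R[i] :=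
  sval (closed_field_poly_normal p).

Definition mahler (p : {poly R[i]}) : R[i] :=
  `|lead_coef p| * \prod_(a <- croots p) Num.max 1 `|a|.

Definition mahlerZ (P : {poly int}) : R[i] := mahler (map_poly intr P).

Lemma mahlerE (a : R[i]) (rs : seq R[i]) :
  mahler (a *: \prod_(z <- rs) ('X - z%:P)) =
  `|a| * \prod_(z <- rs) Num.max 1 `|z|.
Proof.
set p := a *: _.
have lp : lead_coef p = a.
  by rewrite lead_coefZ (monicP (monic_prod_XsubC _ _ _)) mulr1.
rewrite /mahler lp /croots; case: closed_field_poly_normal => s /= ps.
have [->|a0] := eqVneq a 0; first by rewrite normr0 !mul0r.
have /(scalerI a0)/prod_XsubC_eq e :
    a *: \prod_(z <- rs) ('X - z%:P) = a *: \prod_(z <- s) ('X - z%:P).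
  by rewrite -{2}lp.
by rewrite (perm_big _ e).
Qed.

(* For a monic integer polynomial, irreducibility in Z[X] and in Q[X] agree. *)
Definition generalized_garsia (P : {poly int}) : Prop :=
  [/\ P \is monic,
      irreducible_poly (map_poly intr P : {poly rat}),
      expansive (map_poly intr P) &
      2 <= mahlerZ P].

Definition salem (T : {poly int}) : Prop :=
  let TC : {poly R[i]} := map_poly intr T in
  [/\ T \is monic,
      reciprocal T,
      exists beta : R,
        [/\ 1 < beta, mup (real_complex R beta) TC = 1%N &
            forall z : R[i], root TC z -> 1 < `|z| -> z = real_complex R beta] &
      exists z : R[i], root TC z /\ `|z| = 1].

Definition simple_roots (p : {poly R[i]}) : Prop :=
  forall z : R[i], root p z -> mup z p = 1%N.

End Definitions.

(* Main.v *)
Require Import Defs.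
From mathcomp Require Import all_boot all_order all_algebra.
From mathcomp Require Import reals complex.
From mathcomp Require Import polyrcf ring.
Import Order.TTheory GRing.Theory Num.Theory.
Local Open Scope ring_scope.

(** Write [Q = P + Pd - T].  Most of the work is to show that [Q] is again
    expansive; the rest follows from [Q(0) = P(0) + Pd(0) - 1] being prime.

    Expansivity of a polynomial [P] over [T] is, up to a condition at the point
    [1], a family of sign conditions that are linear in [P].  Let [1/b < 1 < b]
    be the real roots of [T]; its other roots [t] are simple and on the unit
    circle.

    - If [P] is expansive then [B = P^*/P] is a finite Blaschke product, and
      [(z-1) T = z P - P^*] says that the roots of [T] are fixed points of [B].
      One of them, [1/b], lies inside the disk, so by the Schwarz-Pick lemma [B]
      has derivative at least [1] at each boundary fixed point [t].  As
      [B'(t) - 1 = (1-t) T'(t) / P(t)] and [t] is a simple root, this gives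
      [P(t) / ((1-t) T'(t)) > 0] ([boundary_fixed_point], [residue_gt0]).

    - Conversely, let [Q] be monic of the degree of [T], with [Q(-1) = T(-1)],
      [Q(1) > 0] and [Q(t) / ((1-t) T'(t)) > 0] for all [t].  Let [D] be the
      product of [X-1] and of all the [X-t].  Then [-Q/D] is the sum of a
      constant, of [-z], and of positive multiples of the kernels [t/(t-z)],
      whose real part is least on the unit circle.  Comparing with the value at
      [-1] gives [Re(-Q/D) > 1 - Re z >= 0] on the closed disk, hence [Q] has no
      root there; nor does it vanish at the roots of [D]
      ([roots_outside_disk], [residues_expansive]).

    The sign conditions and the value at [-1] pass from [P] and [Pd] to [Q],
    because [T] vanishes at each [t].  Moreover [T(1) < 0 < P(1), Pd(1)], so that
    [Q(1) > 0].

    Finally, an integer factor of positive degree of the monic expansive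
    polynomial [Q] has a constant term of modulus greater than [1], which leaves
    no room for two such factors when [Q(0)] is prime; and the Mahler measure of
    [Q] is the product of the moduli of its roots, which is [|Q(0)|]. *)

(** * Polynomials and their roots *)

Lemma poly_ext_off (A : numDomainType) (a : A) (p q : {poly A}) :
  (forall z, z != a -> p.[z] = q.[z]) -> p = q.
Proof.
move=> pq; apply/eqP; rewrite -subr_eq0; apply/eqP.
apply: (@roots_geq_poly_eq0 _ _ [seq a + k%:R | k <- iota 1 (size (p - q))]).
- apply/allP => x /mapP[k]; rewrite mem_iota => /andP[k0 _] ->.
  rewrite rootE hornerD hornerN pq ?subrr //.
  by rewrite -subr_eq0 addrAC subrr add0r pnatr_eq0 -lt0n.
- rewrite map_inj_uniq ?iota_uniq // => i j /addrI /eqP.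
  by rewrite eqr_nat => /eqP.
- by rewrite size_map size_iota.
Qed.

Lemma deriv_at_root (A : comNzRingType) (t : A) (p : {poly A}) :
  (('X - t%:P) * p)^`().[t] = p.[t].
Proof.
by rewrite derivM derivXsubC !hornerE subrr mul0r addr0.
Qed.

Lemma deriv_prod_XsubC_neq0 (F : fieldType) (s : seq F) (t : F) :
  uniq s -> t \in s -> (\prod_(a <- s) ('X - a%:P))^`().[t] != 0.
Proof.
move=> us ts; rewrite (big_rem t) //= deriv_at_root -rootE root_prod_XsubC.
by rewrite mem_rem_uniq // !inE eqxx.
Qed.

Lemma norm_prod_XsubC0 (C : numDomainType) (s : seq C) :
  `|(\prod_(a <- s) ('X - a%:P)).[0]| = \prod_(a <- s) `|a|.
Proof.
rewrite horner_prod normr_prod; apply: eq_bigr => a _.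
by rewrite hornerXsubC sub0r normrN.
Qed.

Lemma prod_norm_gt1 (C : numDomainType) (s : seq C) :
  (0 < size s)%N -> {in s, forall a, 1 < `|a|} -> 1 < \prod_(a <- s) `|a|.
Proof.
elim: s => // a s IHs _ s1; rewrite big_cons.
have a1 : 1 < `|a| by apply: s1; rewrite mem_head.
case: s IHs s1 => [|b s] IHs s1; first by rewrite big_nil mulr1.
apply: (lt_trans a1); rewrite ltr_pMr ?(lt_trans ltr01) //.
by apply: IHs => // c sc; apply: s1; rewrite inE sc orbT.
Qed.

(** * Boundary fixed points of finite Blaschke products *)

(** The numerator of the Blaschke product with denominator
    [\prod_(a <- s) ('X - a%:P)]. *)
Definition mirror (C : numClosedFieldType) (s : seq C) : {poly C} :=
  \prod_(a <- s) (1 - a^* *: 'X).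

(** The Pick kernel [(1 - B(z) conj B(w)) / (1 - z conj w)] of a finite Blaschke
    product is a sum of squares: with one more factor, it is enough that
    [(z - a) conj(w - a) - (1 - conj(a) z) conj(1 - conj(a) w)] be equal to
    [(|a|^2 - 1) (1 - z conj w)]. *)
Lemma blaschke_kernel (C : numClosedFieldType) (s : seq C) :
  {in s, forall a, 1 <= `|a|} ->
  exists es : seq {poly C}, forall z w,
    (\prod_(a <- s) ('X - a%:P)).[z] * ((\prod_(a <- s) ('X - a%:P)).[w])^* -
      (mirror C s).[z] * ((mirror C s).[w])^* =
    (1 - z * w^*) * \sum_(e <- es) e.[z] * e.[w]^*.
Proof.
rewrite /mirror; elim: s => [|a s IHs] s1.
  exists [::] => z w.
  by rewrite !big_nil !hornerC conjC1 mulr1 subrr mulr0.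
have [|es IH] := IHs; first by move=> x xs; apply: s1; rewrite in_cons xs orbT.
have a1 : 0 <= `|a| ^+ 2 - 1.
  by rewrite subr_ge0 exprn_ege1 // s1 // mem_head.
exists (sqrtC (`|a| ^+ 2 - 1) *: \prod_(a <- s) (1 - a^* *: 'X) ::
        [seq ('X - a%:P) * e | e <- es]) => z w.
rewrite !big_cons big_map hornerM [in X in _ - X]hornerM.
have -> : \sum_(e <- es) (('X - a%:P) * e).[z] * ((('X - a%:P) * e).[w])^* =
    (z - a) * (w - a)^* * \sum_(e <- es) e.[z] * (e.[w])^*.
  rewrite mulr_sumr; apply: eq_bigr => e _.
  by rewrite !hornerM !hornerXsubC rmorphM /=; ring.
move: (IH z w); rewrite !hornerM.
set A := horner _ z; set B := horner _ w; set A' := horner _ z.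
set B' := horner _ w; set S := \sum_(e <- es) _ => E.
rewrite !hornerZ -/A' -/B' !hornerE !rmorphM !rmorphB !rmorph1 /= !rmorphM /=.
rewrite conjCK (geC0_conj (x := sqrtC _)) ?sqrtC_ge0 //.
have -> : sqrtC (`|a| ^+ 2 - 1) * A' * (sqrtC (`|a| ^+ 2 - 1) * B'^*) =
    (a * a^* - 1) * (A' * B'^*).
  by rewrite mulrACA -expr2 sqrtCK normCK.
have {}E : A * B^* = A' * B'^* + (1 - z * w^*) * S by rewrite -E; ring.
by ring: E.
Qed.

Lemma norm1_conj_mul (C : numClosedFieldType) (t : C) : `|t| = 1 -> t * t^* = 1.
Proof. by move=> t1; rewrite -normCK t1 expr1n. Qed.

(** A finite Blaschke product with a fixed point [b] inside the disk has derivative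
    at least [1] at a fixed point [t] on the circle: this is the positivity of its
    Pick kernel at the pair of points [t], [b].  Here the denominator is [P], the
    numerator [mirror C s], and [T] describes the fixed points.  The conclusion is
    [|P(t)|^2 (B'(t) - 1) >= 0]. *)
Lemma boundary_fixed_point (C : numClosedFieldType) (s : seq C) (T : {poly C})
    (b t : C) :
  {in s, forall a, 1 < `|a|} ->
  'X * (\prod_(a <- s) ('X - a%:P)) - mirror C s = ('X - 1) * T ->
  `|b| < 1 -> `|t| = 1 -> root T b -> root T t ->
  0 <= (\prod_(a <- s) ('X - a%:P)).[t]^* * ((1 - t) * T^`().[t]).
Proof.
move=> s1; set P := \prod_(a <- s) _ => PT b1 t1 /rootP Tb rTt.
have [|es K] := blaschke_kernel C s; first by move=> a /s1/ltW.
move: K; rewrite -/P => K.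
have ME z : (mirror C s).[z] = z * P.[z] - (z - 1) * T.[z].
  by move/(congr1 (horner^~ z)): PT; rewrite !hornerE => <-; ring.
have Mb : (mirror C s).[b] = b * P.[b] by rewrite ME Tb; ring.
have Mt : (mirror C s).[t] = t * P.[t] by rewrite ME (rootP rTt); ring.
have tt := norm1_conj_mul _ _ t1.
have Pb : P.[b] != 0.
  rewrite -rootE /P; apply/negP; rewrite root_prod_XsubC => /s1 /(lt_trans b1).
  by rewrite ltxx.
have [T1 TE] := factor_theorem T t rTt.
have T't : T^`().[t] = T1.[t].
  by rewrite TE derivM derivXsubC hornerD !hornerM hornerXsubC subrr hornerC;
    ring.
have nz x : `|x| <= 1 -> 1 - x * b^* != 0.
  move=> x1; rewrite subr_eq0; apply/negP => /eqP /(congr1 Num.norm).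
  rewrite normrM norm_conjC normr1 => xb; have := ler_piMl (normr_ge0 b) x1.
  by rewrite -xb => /le_lt_trans /(_ b1); rewrite ltxx.
have E1 : \sum_(e <- es) e.[b] * e.[b]^* = P.[b] * P.[b]^*.
  by apply: (mulfI (nz b (ltW b1))); rewrite -K Mb rmorphM /=; ring.
have E2 : \sum_(e <- es) e.[t] * e.[b]^* = P.[t] * P.[b]^*.
  have t_le1 : `|t| <= 1 by rewrite t1.
  by apply: (mulfI (nz t t_le1)); rewrite -K Mb Mt rmorphM /=; ring.
(* The kernel on the diagonal at [t]: both sides of the kernel identity carry the
   factor [1 - z t^* = (t - z) t^*], which is cancelled for [z != t]; by continuity,
   here polynomiality, the quotients agree at [z = t] as well. *)
have E3 : \sum_(e <- es) e.[t] * e.[t]^* = P.[t]^* * (P.[t] + (1 - t) * T1.[t]).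
  have pE : \sum_(e <- es) e.[t]^* *: e = P.[t]^* *: (P + (1 - 'X) * T1).
    apply: (poly_ext_off _ t) => z zt.
    have nzt : 1 - z * t^* != 0.
      rewrite -tt -mulrBl mulf_eq0 subr_eq0 (eq_sym t) (negPf zt) conjC_eq0.
      by rewrite -normr_eq0 t1 oner_eq0.
    apply: (mulfI nzt); rewrite horner_sum.
    under eq_bigr do rewrite hornerZ mulrC.
    rewrite -K Mt ME TE !hornerE rmorphM /=.
    by ring: tt.
  move/(congr1 (horner^~ t)): pE; rewrite horner_sum.
  by under eq_bigr do rewrite hornerZ mulrC; move=> ->; rewrite !hornerE.
(* With these weights on [t] and [b], the kernel entries other than the one at
   [(t, t)] add up to [- |P(b)|^2 |P(t)|^2], which cancels the term [|P(t)|^2]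
   of [E3]. *)
have : 0 <= \sum_(e <- es) `|P.[b] * e.[t] - P.[t] * e.[b]| ^+ 2.
  by apply: sumr_ge0 => e _; rewrite exprn_ge0.
have E2' : \sum_(e <- es) e.[b] * e.[t]^* = P.[b] * P.[t]^*.
  have /(congr1 Num.conj) := E2; rewrite rmorph_sum /= => E2'.
  rewrite [RHS]mulrC -[RHS](_ : (P.[t] * P.[b]^*)^* = _); last first.
    by rewrite rmorphM /= conjCK.
  by rewrite -E2'; apply: eq_bigr => e _; rewrite rmorphM /= conjCK mulrC.
have -> : \sum_(e <- es) `|P.[b] * e.[t] - P.[t] * e.[b]| ^+ 2 =
    `|P.[b]| ^+ 2 * (P.[t]^* * ((1 - t) * T^`().[t])).
  transitivity (P.[b] * P.[b]^* * \sum_(e <- es) e.[t] * e.[t]^* -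
      P.[b] * P.[t]^* * (\sum_(e <- es) e.[t] * e.[b]^*) -
      P.[t] * P.[b]^* * (\sum_(e <- es) e.[b] * e.[t]^*) +
      P.[t] * P.[t]^* * (\sum_(e <- es) e.[b] * e.[b]^*)).
    rewrite !mulr_sumr -!sumrB -big_split; apply: eq_bigr => e _ /=.
    by rewrite normCK rmorphB !rmorphM /=; ring.
  by rewrite E1 E2 E2' E3 T't normCK; ring.
by rewrite pmulr_rge0 // exprn_gt0 // normr_gt0.
Qed.

(** * Functions with positive real part on the disk *)

Lemma partial_fractions (F : fieldType) (s : seq F) (p : {poly F}) (z : F) :
  uniq s -> (size p <= size s)%N -> z \notin s ->
  let D := \prod_(t <- s) ('X - t%:P) in
  p.[z] / D.[z] = \sum_(t <- s) p.[t] / D^`().[t] / (z - t).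
Proof.
move=> us ps zs D.
have DE t : t \in s -> D = ('X - t%:P) * \prod_(i <- rem t s) ('X - i%:P).
  by move=> ts; rewrite /D (big_rem t).
have D't t : t \in s -> D^`().[t] = (\prod_(i <- rem t s) ('X - i%:P)).[t].
  by move=> ts; rewrite (DE t ts) deriv_at_root.
have pE : p = \sum_(t <- s)
    (p.[t] / D^`().[t]) *: \prod_(i <- rem t s) ('X - i%:P).
  apply/eqP; rewrite -subr_eq0; apply/eqP.
  apply: (@roots_geq_poly_eq0 _ _ s) => //.
    apply/allP => u us'; rewrite rootE hornerD hornerN horner_sum (big_rem u) //=.
    rewrite hornerZ -D't // divfK ?deriv_prod_XsubC_neq0 //.
    rewrite big_seq big1 ?addr0 ?subrr // => t; rewrite mem_rem_uniq // !inE.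
    move=> /andP[tu ts]; rewrite hornerZ; apply/eqP.
    rewrite mulf_eq0 -[X in _ || X]rootE root_prod_XsubC mem_rem_uniq //.
    by rewrite !inE us' (eq_sym u t) tu orbT.
  rewrite (leq_trans (size_polyD _ _)) // geq_max ps size_polyN.
  rewrite (leq_trans (size_sum _ _ _)) //; apply/bigmax_leqP_seq => t ts _.
  rewrite (leq_trans (size_scale_leq _ _)) // size_prod_XsubC size_rem //.
  by rewrite prednK // -has_predT; apply/hasP; exists t.
have Dz : D.[z] != 0 by rewrite -rootE root_prod_XsubC.
rewrite {1}pE horner_sum mulr_suml; apply: eq_big_seq => t ts.
have zt : z - t != 0 by rewrite subr_eq0; apply: contraNneq zs => ->.
move: Dz; rewrite hornerZ (DE t ts) hornerM hornerXsubC mulf_eq0 negb_or.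
set G := _.[z] => /andP[_ G0]; rewrite -!mulrA; do 2 congr (_ * _).
by field; rewrite zt G0.
Qed.

(** The last summand is the Poisson kernel, which is nonnegative in the closed disk
    and vanishes on the circle. *)
Lemma herglotz_kernel (C : numClosedFieldType) (t z : C) :
  `|t| = 1 -> z != t ->
  t / (t - z) + (t / (t - z))^* = 1 + (1 - `|z| ^+ 2) / `|t - z| ^+ 2.
Proof.
move=> /norm1_conj_mul tt; rewrite -subr_eq0 => zt.
have tz : t - z != 0 by rewrite -opprB oppr_eq0.
have tz' : t^* - z^* != 0 by rewrite -rmorphB conjC_eq0.
rewrite !normCK rmorphM fmorphV rmorphB /=.
field: tt; rewrite tz tz' //.
Qed.

(** The residue conditions make [-Q/D] equal to [- c - z] plus positive multiples of
    the kernels [t / (t - z)].  These have real part at least [1/2] in the closed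
    disk and exactly [1/2] at [-1], so
    [Re(-Q/D)(z) + Re z >= Re(-Q/D)(-1) - 1 > 1], and [Q] cannot vanish at [z]. *)
Lemma roots_outside_disk (C : numClosedFieldType) (s : seq C) (Q : {poly C}) :
  let D := \prod_(t <- s) ('X - t%:P) in
  uniq s -> {in s, forall t, `|t| = 1} -> -1 \notin s ->
  Q \is monic -> size Q = (size s).+2 ->
  {in s, forall t, 0 < Q.[t] / (t * D^`().[t])} ->
  2 < - (Q.[-1] / D.[-1]) ->
  forall z, root Q z -> 1 < `|z|.
Proof.
move=> D us s1 sN1 mQ sQ rho_gt0 QN1 z /rootP Qz.
have mD : D \is monic by rewrite monic_prod_XsubC.
have sD : size D = (size s).+1 by rewrite size_prod_XsubC.
(* [X + c] is the quotient of [Q] by [D], and [R0] the remainder. *)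
pose c := (Q - 'X * D)`_(size s).
pose R0 := Q - ('X + c%:P) * D.
have Dn : D`_(size s) = 1 by have /monicP := mD; rewrite lead_coefE sD.
have Qn : Q`_(size s).+1 = 1 by have /monicP := mQ; rewrite lead_coefE sQ.
have sR0 : (size R0 <= size s)%N.
  apply/leq_sizeP => j; rewrite /R0 mulrDl coefD coefN coefD coefCM.
  rewrite leq_eqVlt => /predU1P[<-|].
    by rewrite Dn /c coefD coefN; ring.
  rewrite leq_eqVlt => /predU1P[<-|].
    by rewrite coefXM /= Dn Qn [D`__]nth_default ?sD //; ring.
  case: j => // j j_gt; rewrite coefXM /=.
  by rewrite [Q`__]nth_default ?sQ // ![D`__]nth_default ?sD // 1?ltnW //; ring.
have R0s t : t \in s -> R0.[t] = Q.[t].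
  move=> ts; have /rootP Dt : root D t by rewrite root_prod_XsubC.
  by rewrite !hornerE Dt; ring.
have R0s' u : u \notin s -> Q.[u] / D.[u] = u + c + R0.[u] / D.[u].
  move=> us'; have Du : D.[u] != 0 by rewrite -rootE root_prod_XsubC.
  by rewrite !hornerE; field.
pose rho t := Q.[t] / (t * D^`().[t]).
have tn0 t : t \in s -> t != 0 by move/s1 => t1; rewrite -normr_eq0 t1 oner_eq0.
have rho_real t : t \in s -> (rho t)^* = rho t.
  by move=> ts; rewrite geC0_conj // ltW ?rho_gt0.
have H u : u \notin s -> - (Q.[u] / D.[u]) =
    - c - u + \sum_(t <- s) rho t * (t / (t - u)).
  move=> uns; rewrite R0s' // (partial_fractions _ s) //.
  rewrite -/D !opprD [- u + _]addrC -sumrN; congr (_ + _).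
  apply: eq_big_seq => t ts; rewrite R0s //.
  have ut : u - t != 0 by rewrite subr_eq0; apply: contraNneq uns => ->.
  rewrite -[t - u]opprB /rho invrN !invfM.
  move: (Q.[t]) (D^`().[t])^-1 => q d.
  by field; rewrite ut tn0.
pose K := - c - c^* + \sum_(t <- s) rho t.
have HH u : u \notin s -> - (Q.[u] / D.[u]) + (- (Q.[u] / D.[u]))^* + u + u^* =
    K + \sum_(t <- s) rho t * ((1 - `|u| ^+ 2) / `|t - u| ^+ 2).
  move=> uns; rewrite H // /K rmorphD rmorphB rmorphN rmorph_sum /=.
  transitivity (- c - c^* + (\sum_(t <- s) rho t * (t / (t - u)) +
                 \sum_(t <- s) (rho t * (t / (t - u)))^*)); first by ring.
  rewrite -[RHS]addrA -!big_split /=; congr (_ + _); apply: eq_big_seq => t ts.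
  rewrite rmorphM /= rho_real // -mulrDr (herglotz_kernel _ _ _ (s1 t ts)).
    by rewrite mulrDr mulr1.
    by apply: contraNneq uns => ->.
have [zs|zs] := boolP (z \in s).
  by have := rho_gt0 z zs; rewrite Qz mul0r ltxx.
have zR : `|z| \is Num.real := normr_real z.
rewrite real_ltNge ?rpred1 //; apply/negP => z1.
pose N : C := - (Q.[-1] / D.[-1]).
have KE : K = N + N - 2.
  have := HH _ sN1; rewrite normrN1 expr1n subrr.
  rewrite [\sum_(_ <- _) _]big1; last by move=> t _; rewrite mul0r mulr0.
  rewrite addr0 => <-; rewrite -/N rmorphN1 geC0_conj; first by ring.
  by rewrite ltW // (lt_trans _ QN1) // ltr0n.
have := HH _ zs; rewrite Qz mul0r oppr0 rmorph0 !add0r => E.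
have S_ge0 : 0 <= \sum_(t <- s) rho t * ((1 - `|z| ^+ 2) / `|t - z| ^+ 2).
  rewrite big_seq; apply: sumr_ge0 => t ts; apply: mulr_ge0.
    exact/ltW/rho_gt0.
  by rewrite divr_ge0 ?exprn_ge0 // subr_ge0 exprn_ile1.
have z_re : z + z^* <= 2.
  have : 0 <= `|1 - z| ^+ 2 by rewrite exprn_ge0.
  have z2 : `|z| ^+ 2 <= 1 by rewrite exprn_ile1.
  rewrite normCK rmorphB rmorph1.
  have -> : (1 - z) * (1 - z^*) = 1 + `|z| ^+ 2 - (z + z^*).
    by rewrite normCK; ring.
  by rewrite subr_ge0 => /le_trans; apply; rewrite [leRHS]mulr2n lerD2l.
have : 2 < z + z^*.
  by rewrite E ltr_wpDr // KE ltrBrDr ltrD.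
by move=> /lt_le_trans /(_ z_re); rewrite ltxx.
Qed.

(** * Integer polynomials *)

Lemma size_map_int (A : numDomainType) (P : {poly int}) :
  size (map_poly (intr : int -> A) P) = size P.
Proof. by apply: size_map_inj_poly; [exact: intr_inj | rewrite rmorph0]. Qed.

Lemma map_recip_int (A : numDomainType) (P : {poly int}) :
  map_poly intr (recip P) = recip (map_poly (intr : int -> A) P).
Proof.
apply/polyP => i; rewrite coef_map coef_poly [RHS]coef_poly size_map_int.
by case: ifP => _; rewrite ?coef_map /= ?rmorph0.
Qed.

Lemma conj_horner_int (C : numClosedFieldType) (P : {poly int}) (z : C) :
  ((map_poly intr P).[z])^* = (map_poly intr P).[z^*].
Proof.
rewrite -horner_map -map_poly_comp; congr (horner _ _).
by apply: eq_map_poly => k; apply: rmorph_int.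
Qed.

(** Real coefficients identify the reciprocal polynomial, whose factors are
    [1 - a z], with the Blaschke numerator, whose factors are [1 - a^* z]. *)
Lemma mirrorE (C : numClosedFieldType) (P : {poly int}) (s : seq C) :
  map_poly intr P = \prod_(a <- s) ('X - a%:P) ->
  mirror C s = map_poly intr (recip P).
Proof.
move=> PE; rewrite map_recip_int.
apply: (poly_ext_off C 0) => z z0.
apply: (can_inj (@conjCK C)).
rewrite horner_recip // rmorphM rmorphXn /= conj_horner_int PE.
rewrite size_prod_XsubC /= fmorphV !horner_prod rmorph_prod /=.
have z'0 : z^* != 0 by rewrite conjC_eq0.
elim: s {PE} => [|a s IHs]; first by rewrite !big_nil mulr1.
rewrite !big_cons exprS IHs !hornerE rmorphB rmorphM /= conjCK rmorph1.
by field.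
Qed.

Section Garsia.
Variable R : realType.
Implicit Types P Q T : {poly int}.

Lemma map_real_complex P :
  map_poly (real_complex R) (map_poly intr P) = map_poly intr P.
Proof.
rewrite -map_poly_comp; apply: eq_map_poly => k.
by rewrite /= (rmorph_int (real_complex R)).
Qed.

Lemma monic_int_split P :
  P \is monic ->
  exists s : seq R[i], map_poly intr P = \prod_(a <- s) ('X - a%:P).
Proof.
move=> mP; have [s sE] := closed_field_poly_normal (map_poly intr P : {poly R[i]}).
by exists s; rewrite sE (monicP (monic_map _ mP)) scale1r.
Qed.

Lemma expansive_split P :
  P \is monic -> expansive (map_poly intr P : {poly R}) ->
  exists2 s : seq R[i], map_poly intr P = \prod_(a <- s) ('X - a%:P) &
    {in s, forall a, 1 < `|a|}.
Proof.
move=> mP [_ eP]; have [s sE] := monic_int_split P mP.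
exists s => // a sa; apply: eP.
by rewrite map_real_complex sE root_prod_XsubC.
Qed.

(** * Monic expansive polynomials *)

Lemma mahler_expansive P :
  P \is monic -> expansive (map_poly intr P : {poly R}) ->
  mahlerZ R P = `|P.[0]|%:~R.
Proof.
move=> mP eP; have [s sE s1] := expansive_split P mP eP.
rewrite /mahlerZ sE -[X in mahler X]scale1r mahlerE normr1 mul1r.
rewrite intr_norm -(horner_map (intr : int -> R[i])) rmorph0 sE norm_prod_XsubC0.
apply: eq_big_seq => a /s1 a1.
by apply: max_r; apply: ltW.
Qed.

(** All the roots of [f] are roots of [P], and the leading coefficient of [f] is a
    unit, so [|f(0)|] is a product of moduli that are greater than [1]. *)
Lemma expansive_factor P f g :
  P \is monic -> expansive (map_poly intr P : {poly R}) -> P = f * g ->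
  `|f.[0]| <= 1 -> size f = 1.
Proof.
move=> mP [_ eP] PE f0.
have lf1 : `|lead_coef f| = 1.
  have := monicP mP; rewrite PE lead_coefM => /(congr1 absz)/eqP.
  by rewrite abszM muln_eq1 -abszE => /andP[/eqP ->].
have [s sE] := closed_field_poly_normal (map_poly intr f : {poly R[i]}).
have lc : lead_coef (map_poly (intr : int -> R[i]) f) = (lead_coef f)%:~R.
  by rewrite lead_coef_map_inj //; apply: intr_inj.
have lf0 : (lead_coef f)%:~R != 0 :> R[i].
  by rewrite intr_eq0 -normr_eq0 lf1.
rewrite lc in sE.
have sf : size f = (size s).+1.
  by rewrite -(size_map_int R[i]) sE size_scale // size_prod_XsubC.
rewrite sf; case: (posnP (size s)) => [->//|s0].
have s1 : {in s, forall a, 1 < `|a|}.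
  move=> a sa; apply: eP; rewrite map_real_complex PE rmorphM /= rootM.
  by rewrite sE rootZ // root_prod_XsubC sa.
have := prod_norm_gt1 _ s s0 s1.
rewrite -norm_prod_XsubC0.
have -> : `|(\prod_(a <- s) ('X - a%:P)).[0]| = `|f.[0]|%:~R :> R[i].
  rewrite intr_norm -(horner_map (intr : int -> R[i])) rmorph0 sE hornerZ normrM.
  by rewrite -intr_norm lf1 mul1r.
by rewrite ltr1z ltNge f0.
Qed.

(** By Gauss's lemma a rational factorization comes from an integer one, [P = f g];
    since [|f(0)| |g(0)| = p], one of the two has constant term [1] or [-1], and
    [expansive_factor] makes it constant. *)
Lemma expansive_prime_irreducible P (p : nat) :
  P \is monic -> expansive (map_poly intr P : {poly R}) -> prime p -> P.[0] = p%:Z ->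
  irreducible_poly (map_poly intr P : {poly rat}).
Proof.
move=> mP eP pp P0; split.
  by rewrite size_map_int -(size_map_int R); case: eP.
move=> q q1 /dvdpP_rat_int [f [a a0 qE] [g PE]].
have f1 : size f != 1 by rewrite -(size_map_int rat) -(size_scale _ a0) -qE.
have := P0; rewrite PE hornerM => /(congr1 absz); rewrite abszM /= => fg.
have /primeP[_ /(_ `|f.[0]|%N)] := pp.
rewrite -fg dvdn_mulr // => /(_ isT) /orP[/eqP f0 | /eqP f0].
  case/eqP: f1; apply: (expansive_factor P f g) => //.
  by rewrite -abszE f0.
have g0 : `|g.[0]| <= 1.
  have : (0 < `|f.[0]|)%N.
    by move: (prime_gt0 pp); rewrite -fg muln_gt0 => /andP[].
  rewrite -abszE => fp; move/eqP: f0; rewrite -{1}[`|f.[0]|%N]muln1.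
  by rewrite eqn_pmul2l // => /eqP <-.
have : size g = 1.
  by apply: (expansive_factor P g f) => //; rewrite mulrC.
move=> /eqP /size_poly1P [c c0 gE].
rewrite qE gE rmorphM /= map_polyC /= mulrC mul_polyC.
by rewrite (eqp_ltrans (eqp_scale _ a0)) eqp_sym eqp_scale // intr_eq0.
Qed.

Lemma norm_real_complex (x : R) : `|real_complex R x| = real_complex R `|x|.
Proof. by rewrite normc_def /= expr0n addr0 sqrtr_sqr. Qed.

Lemma expansive_horner1_gt0 P :
  expansive (map_poly intr P : {poly R}) -> 0 < P.[0] -> 0 < P.[1].
Proof.
move=> [_ eP] P0; rewrite ltNge; apply/negP => P1.
have [||x /itvP x01 rx] := @polyrcf.poly_ivt _ (map_poly intr P : {poly R}) 0 1.
- exact: ler01.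
- have -> : (map_poly intr P : {poly R}).[0] = P.[0]%:~R.
    by rewrite -(horner_map (intr : int -> R)) rmorph0.
  have -> : (map_poly intr P : {poly R}).[1] = P.[1]%:~R.
    by rewrite -(horner_map (intr : int -> R)) rmorph1.
    by rewrite pmulr_rle0 ?ltr0z ?lerz0.
have : root (map_poly (real_complex R) (map_poly intr P)) (real_complex R x).
  by rewrite fmorph_root.
move/eP; rewrite norm_real_complex -(rmorph1 (real_complex R)) ltcR.
by rewrite ger0_norm ?x01 // ltNge x01.
Qed.

(** * Salem polynomials *)

(** Divide by [X - beta]: the quotient is monic and has no real root [x >= 1],
    hence it is positive at [1]. *)
Lemma salem_horner1_lt0 T : salem R T -> T.[1] != 0 -> T.[1] < 0.
Proof.
move=> [mT _ [beta [beta1 mub bmax]] _] T1; rewrite lt_neqAle T1 /= leNgt.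
apply/negP => T1_gt0.
pose TR : {poly R} := map_poly intr T.
have TRC : map_poly (real_complex R) TR = map_poly intr T.
  exact: map_real_complex.
have mTR : TR \is monic := monic_map _ mT.
have rb : root TR beta.
  rewrite -(fmorph_root (real_complex R)) TRC; apply/negPn/negP.
  by move/mupNroot; rewrite mub.
have [G TG] := factor_theorem TR beta rb.
have mG : G \is monic by move: mTR; rewrite TG monicMr ?monicXsubC.
have Gb : ~~ root G beta.
  apply/negP => Gb.
  have : (1 < mup (real_complex R beta) (map_poly intr T : {poly R[i]}))%N.
    rewrite mup_geq ?monic_neq0 ?monic_map // -TRC TG rmorphM /=.
    rewrite rmorphB /= map_polyX map_polyC expr2 dvdp_mul2r.
      by rewrite dvdp_XsubCl fmorph_root.
    exact: monic_neq0 (monicXsubC _).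
  by rewrite mub.
have TR1 : TR.[1] = (T.[1])%:~R.
  by rewrite -(horner_map (intr : int -> R)) rmorph1.
have G1 : G.[1] < 0.
  have : 0 < TR.[1] by rewrite TR1 ltr0z.
  rewrite TG hornerM hornerXsubC mulrC nmulr_rgt0 //.
  by rewrite subr_lt0.
have [n Gn] : exists n, forall x, n <= x -> lead_coef G <= G.[x].
  by apply: poly_pinfty_gt_lc; rewrite (monicP mG).
pose N := Num.max 1 n.
have GN : 0 < G.[N].
  by rewrite (lt_le_trans _ (Gn N _)) ?(monicP mG) // le_max lexx orbT.
have [||x /= /andP[x_ge1 _] rx] := @poly_ivt _ G 1 N.
- by rewrite le_max lexx.
- by rewrite !ltW.
have rTx : root TR x by rewrite TG rootM rx.
have x1 : 1 < x.
  rewrite lt_neqAle x_ge1 andbT; apply/eqP => x1.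
  by move: rTx; rewrite -x1 rootE TR1 intr_eq0 (negPf T1).
have : real_complex R x = real_complex R beta.
  apply: bmax; first by rewrite -TRC fmorph_root.
  rewrite norm_real_complex -(rmorph1 (real_complex R)) ltcR.
  by rewrite gtr0_norm // (lt_trans ltr01).
by move/complexI => xb; move: Gb; rewrite -xb rx.
Qed.

(** The inverse of a root of a reciprocal polynomial is a root, so besides [b] and
    [b^-1] no root can leave the unit circle. *)
Lemma salem_split T :
  salem R T -> simple_roots (map_poly intr T : {poly R[i]}) ->
  exists (b : R[i]) (s : seq R[i]),
    [/\ 1 < b, map_poly intr T = \prod_(t <- [:: b, b^-1 & s]) ('X - t%:P),
        uniq [:: b, b^-1 & s] & {in s, forall t, `|t| = 1}].
Proof.
move=> [mT recT [beta [beta1 mub bmax]] _] simT.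
have [r rE] := monic_int_split T mT.
set TC : {poly R[i]} := map_poly intr T in mub bmax simT rE.
have TCr z : root TC z = (z \in r) by rewrite rE root_prod_XsubC.
have ur : uniq r.
  apply: count_mem_uniq => z; rewrite -mu_prod_XsubC -rE -TCr.
  by have [/simT->//|/mupNroot ->] := boolP (root TC z).
set b := real_complex R beta in mub bmax.
have b1 : 1 < b by rewrite -(rmorph1 (real_complex R)) ltcR.
have b0 : 0 < b by apply: lt_trans b1.
have bn0 := lt0r_neq0 b0.
have T0 : TC.[0] = 1.
  rewrite horner_coef0 coef_map /= -recT coef_poly subn0 -lead_coefE (monicP mT).
  by rewrite size_poly_gt0 monic_neq0.
have recTC : recip TC = TC by rewrite -map_recip_int recT.
have rinv z : z \in r -> z^-1 \in r.
  move=> zr; have z0 : z != 0.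
    apply: contraTneq zr => ->; rewrite -TCr rootE T0 oner_eq0 //.
  rewrite -TCr rootE -recTC horner_recip ?invr_eq0 // invrK.
  by move: zr; rewrite -TCr => /rootP ->; rewrite mulr0.
have br : b \in r by rewrite -TCr; apply/negPn/negP => /mupNroot; rewrite mub.
have bVr : b^-1 \in rem b r.
  rewrite mem_rem_uniq // !inE rinv // andbT; apply/eqP => bb.
  have : b^-1 < 1 by rewrite invf_lt1.
  by rewrite bb => /(lt_trans b1); rewrite ltxx.
have pr : perm_eq r [:: b, b^-1 & rem b^-1 (rem b r)].
  by rewrite (perm_trans (perm_to_rem br)) // perm_cons perm_to_rem.
exists b, (rem b^-1 (rem b r)); split=> //.
- by rewrite -/TC rE; apply: perm_big.
- by rewrite -(perm_uniq pr).
move=> t; rewrite mem_rem_uniq ?rem_uniq // inE /= mem_rem_uniq // inE /=.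
move=> /and3P[tbV tb tr].
have t0 : t != 0.
  by apply: contraTneq tr => ->; rewrite -TCr rootE T0 oner_eq0.
have [|t1|] := real_ltgtP (normr_real t) (rpred1 _) => //.
- move=> t1; case/eqP: tbV; rewrite -[LHS]invrK; congr (_^-1).
  apply: bmax; first by rewrite TCr rinv.
  by rewrite normfV invf_gt1 // normr_gt0.
- by case/eqP: tb; apply: bmax; rewrite ?TCr.
Qed.

(** * Expansive polynomials over a Salem polynomial *)

(** The boundary fixed points of [P^*/P], whose fixed point inside the disk is the
    root [b^-1] of [T]. *)
Lemma residue_gt0 P T (t : R[i]) :
  let TC : {poly R[i]} := map_poly intr T in
  salem R T -> simple_roots TC -> T.[1] != 0 ->
  P \is monic -> expansive (map_poly intr P : {poly R}) -> poly_over T P ->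
  root TC t -> `|t| = 1 ->
  0 < (map_poly intr P).[t] / ((1 - t) * TC^`().[t]).
Proof.
move=> TC hT simT T1 mP eP [_ PT] Tt t1.
have [b [s [b1 TE us _]]] := salem_split T hT simT; rewrite -/TC in TE.
have TCr u : root TC u = (u \in [:: b, b^-1 & s]) by rewrite TE root_prod_XsubC.
have T't : TC^`().[t] != 0 by rewrite TE deriv_prod_XsubC_neq0 // -TCr.
have tn1 : t != 1.
  apply: contraTneq Tt => ->; rewrite rootE -[X in TC.[X]]/(1%:~R).
  by rewrite (horner_map (intr : int -> R[i])) intr_eq0.
have TbV : root TC b^-1 by rewrite TCr !inE eqxx orbT.
have bV1 : `|b^-1| < 1.
  have b0 : 0 < b := lt_trans ltr01 b1.
  by rewrite gtr0_norm ?invr_gt0 ?invf_lt1.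
have [r sE s1] := expansive_split P mP eP.
have := boundary_fixed_point R[i] r TC b^-1 t s1 _ bV1 t1 TbV Tt.
rewrite -sE; set PC := map_poly intr P; set w := (1 - t) * _.
have wn0 : w != 0 by rewrite mulf_neq0 // subr_eq0 eq_sym.
have Pt : PC.[t] != 0.
  rewrite -rootE /PC sE root_prod_XsubC; apply/negP => /s1.
  by rewrite t1 ltxx.
move=> ge0; have {}ge0 : 0 <= PC.[t]^* * w.
  apply: ge0; rewrite (mirrorE _ P) //.
  have /(congr1 (map_poly (intr : int -> R[i]))) := PT.
  by rewrite rmorphM !rmorphB rmorphM /= map_polyX rmorph1 => ->.
have -> : PC.[t] / w = `|PC.[t]| ^+ 2 / (PC.[t]^* * w).
  have P't : PC.[t]^* != 0 by rewrite conjC_eq0.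
  by rewrite normCK; field; rewrite P't wn0.
by rewrite divr_gt0 ?exprn_gt0 ?normr_gt0 // lt0r ge0 mulf_neq0 // conjC_eq0.
Qed.

(** The nodes [1] and [t] of [roots_outside_disk] are the roots of
    [D = (X-1) T / ((X-b)(X-1/b))].  There the residue conditions of that lemma are,
    up to positive factors, [Q(1) > 0] and the given ones; and
    [-Q(-1)/D(-1) = (1+b)(1+1/b)/2], which exceeds [2] because [b != 1]. *)
Lemma residues_expansive T Q :
  let TC : {poly R[i]} := map_poly intr T in
  let QC : {poly R[i]} := map_poly intr Q in
  salem R T -> simple_roots TC -> T.[1] != 0 -> T.[-1] != 0 ->
  Q \is monic -> size Q = size T -> 0 < Q.[1] -> Q.[-1] = T.[-1] ->
  (forall t, root TC t -> `|t| = 1 -> 0 < QC.[t] / ((1 - t) * TC^`().[t])) ->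
  expansive (map_poly intr Q : {poly R}).
Proof.
move=> TC QC hT simT hT1 hTN1 mQ sQ Q1 QN1 resQ.
have [b [s [b1 TE us s1]]] := salem_split T hT simT; rewrite -/TC in TE.
pose D := \prod_(t <- 1 :: s) ('X - t%:P).
have b0 : 0 < b := lt_trans ltr01 b1.
have bn0 := lt0r_neq0 b0.
have bV : 0 < b^-1 by rewrite invr_gt0.
have bV1 : b^-1 < 1 by rewrite invf_lt1.
have TCr t : root TC t = (t \in [:: b, b^-1 & s]) by rewrite TE root_prod_XsubC.
have horner_intz (U : {poly int}) (k : int) :
    (map_poly intr U).[k%:~R] = (U.[k])%:~R :> R[i].
  exact: (horner_map (intr : int -> R[i])).
have TC1 : TC.[1] != 0 by rewrite -[1]/(1%:~R) horner_intz intr_eq0.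
have TCN1 : TC.[-1] != 0 by rewrite -[-1]/((-1)%:~R) horner_intz intr_eq0.
have s_notin u : TC.[u] != 0 -> u \notin s.
  by apply: contra => us'; rewrite -rootE TCr !inE us' !orbT.
have sT : size T = (size s).+3.
  by rewrite -(size_map_int R[i]) -/TC TE size_prod_XsubC.
have uD : uniq (1 :: s) by move: us; rewrite /= => /and3P[_ _ ->]; rewrite s_notin.
have N1D : -1 \notin 1 :: s.
  rewrite inE negb_or s_notin // andbT -subr_eq0 -opprD oppr_eq0.
  by rewrite -[1 + 1]/(2%:R) pnatr_eq0.
(* The derivatives of [T] and of [D] at the nodes are compared through this
   identity. *)
have TD : ('X - 1%:P) * TC = ('X - b%:P) * (('X - b^-1%:P) * D).
  by rewrite TE /D !big_cons; ring.
have D'E u : u \in 1 :: s ->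
    TC.[u] + (u - 1) * TC^`().[u] = (u - b) * (u - b^-1) * D^`().[u].
  move=> us'; have /rootP Du : root D u by rewrite root_prod_XsubC.
  have /(congr1 (fun U => U^`().[u])) := TD.
  by rewrite !derivM !derivXsubC !hornerE Du => E; rewrite [LHS]E; ring.
have eQ : forall z, root QC z -> 1 < `|z|.
  apply: (roots_outside_disk R[i] (1 :: s)) => //.
  - by move=> t; rewrite inE => /predU1P[->|/s1//]; rewrite normr1.
  - exact: monic_map.
  - by rewrite /QC size_map_int sQ sT.
  - move=> t; rewrite -/D inE => /predU1P[->|ts].
      have D'1 := D'E 1 (mem_head _ _).
      rewrite mul1r divr_gt0 //.
        by rewrite -[1]/(1%:~R) horner_intz ltr0z.
      have TC1_lt0 : TC.[1] < 0.
        by rewrite -[1]/(1%:~R) horner_intz ltrz0 (salem_horner1_lt0 T hT hT1).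
      have b_lt0 : (1 - b) * (1 - b^-1) < 0.
        by rewrite nmulr_rlt0 ?subr_gt0 // subr_lt0.
      by move: TC1_lt0; rewrite -[TC.[1]]addr0 -[X in _ + X](mul0r TC^`().[1])
        -[X in X * _](subrr 1) D'1 nmulr_rlt0.
    have tD : t \in 1 :: s by rewrite inE ts orbT.
    have Tt : root TC t by rewrite TCr !inE ts !orbT.
    have t1 := s1 t ts; have tt := norm1_conj_mul _ t t1.
    have tn0 : t != 0 by rewrite -normr_eq0 t1 oner_eq0.
    have tn1 : t != 1 by apply: contraNneq (s_notin _ TC1) => <-.
    have T't : TC^`().[t] != 0.
      by rewrite TE deriv_prod_XsubC_neq0 // !inE ts !orbT.
    have tb : t != b.
      move: us; rewrite /= !inE negb_or => /andP[/andP[_]] + _.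
      by apply: contraNneq => <-.
    have := D'E t tD; rewrite (rootP Tt) add0r => DT.
    (* [- (t - b) (t - 1/b) / t = b + 1/b - t - t^*] is the positive number
       [|b - t|^2 / b]. *)
    have -> : QC.[t] / (t * D^`().[t]) =
        QC.[t] / ((1 - t) * TC^`().[t]) * (`|b - t| ^+ 2 / b).
      have bV1n : `|b^-1| < 1 by rewrite gtr0_norm.
      have tbV : t - b^-1 != 0.
        rewrite subr_eq0; apply: contraTneq bV1n => <-.
        by rewrite t1 ltxx.
      have DE : D^`().[t] = (t - 1) * TC^`().[t] / ((t - b) * (t - b^-1)).
        by rewrite DT mulrC mulKf // mulf_neq0 // subr_eq0.
      have tV : t^* = t^-1 by rewrite -[RHS]mulr1 -tt mulKf.
      rewrite DE normCK rmorphB /= tV (geC0_conj (ltW b0)).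
      move: QC.[t] (TC^`().[t]) T't => x w wn0.
      field; rewrite bn0 tn0 wn0 !subr_eq0 (eq_sym 1) tn1 tb /= andbT.
      by apply: contraNneq tbV => tb1; rewrite -[b^-1]mul1r -tb1 mulfK ?subrr.
    apply: mulr_gt0; first exact: resQ.
    by rewrite divr_gt0 // exprn_gt0 // normr_gt0 subr_eq0 eq_sym.
  - have DN1 : D.[-1] != 0 by rewrite -rootE root_prod_XsubC.
    have TDN1 : TC.[-1] = - ((1 + b) * (1 + b^-1) / 2%:R) * D.[-1].
      have := congr1 (horner^~ (-1)) TD; rewrite !hornerM !hornerXsubC => TDN1.
      apply: (@mulfI _ (-1 - 1)); last by rewrite TDN1; field.
      by rewrite -opprD oppr_eq0 -[1 + 1]/(2%:R) pnatr_eq0.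
    have -> : QC.[-1] = TC.[-1] by rewrite -[-1]/((-1)%:~R) !horner_intz QN1.
    rewrite TDN1 mulNr mulNr opprK mulfK //.
    rewrite -subr_gt0 (_ : _ - _ = (b - 1) ^+ 2 / (2%:R * b)); last by field.
    apply: divr_gt0; first by rewrite exprn_gt0 // subr_gt0.
    by rewrite mulr_gt0 ?ltr0n.
split; first by rewrite size_map_int sQ sT.
by move=> z; rewrite map_real_complex; apply: eQ.
Qed.

(** At [-1] the reciprocal polynomial of even degree takes the same value. *)
Lemma poly_over_hornerN1 P T :
  odd (size P) -> poly_over T P -> P.[-1] = T.[-1].
Proof.
move=> oP [_ /(congr1 (horner^~ (-1)))].
rewrite hornerD hornerN !hornerM hornerX (_ : (recip P).[-1] = P.[-1]).
  rewrite !hornerE => E; apply: (@mulfI _ (-1 - 1)) => //.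
  by rewrite E; ring.
apply: (@intr_inj rat).
have mapN1 (U : {poly int}) : (U.[-1])%:~R = (map_poly intr U).[-1] :> rat.
  by rewrite -(horner_map (intr : int -> rat)) rmorphN1.
rewrite !mapN1 map_recip_int horner_recip ?oppr_eq0 ?oner_eq0 //.
rewrite size_map_int invrN1 -signr_odd.
by case: (size P) oP => //= n /negPf ->; rewrite mul1r.
Qed.

End Garsia.

Theorem corollary2p1 (R : realType) (m : nat) (T P Pd : {poly int}) (p : nat)
    (hm : (4 <= m)%N) (hm_even : ~~ odd m)
    (hT : salem R T) (hTdeg : size T = m.+1)
    (hTsimple : simple_roots (map_poly intr T : {poly R[i]}))
    (hT1 : T.[1] != 0) (hTN1 : T.[-1] != 0)
    (hP : generalized_garsia R P) (hPdeg : size P = m.+1) (hPT : poly_over T P)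
    (hPd : generalized_garsia R Pd) (hPddeg : size Pd = m.+1)
    (hPdT : poly_over T Pd)
    (hP0 : (P.[0])%:~R = mahlerZ R P)
    (hPd0 : (Pd.[0])%:~R = mahlerZ R Pd)
    (hp : prime p) (hsum : P.[0] + Pd.[0] - 1 = p%:Z) :
  [/\ generalized_garsia R (P + Pd - T),
      size (P + Pd - T) = m.+1 &
      mahlerZ R (P + Pd - T) = mahlerZ R P + mahlerZ R Pd - 1].
Proof.
have [mT recT _ _] := hT.
have [mP _ eP _] := hP; have [mPd _ ePd _] := hPd.
set Q := P + Pd - T.
have coefm (U : {poly int}) : U \is monic -> size U = m.+1 -> U`_m = 1.
  by move=> /monicP <- sU; rewrite lead_coefE sU.
have Qm : Q`_m = 1 by rewrite coefB coefD !coefm //; ring.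
have sQ : size Q = m.+1.
  apply/eqP; rewrite eqn_leq; apply/andP; split; last first.
    by rewrite ltnNge; apply/negP => /leq_sizeP /(_ m (leqnn m)); rewrite Qm.
  apply/leq_sizeP => j mj; rewrite coefB coefD !nth_default ?hPdeg ?hPddeg ?hTdeg //.
have mQ : Q \is monic by rewrite monicE lead_coefE sQ Qm.
have T0 : T.[0] = 1.
  by rewrite horner_coef0 -recT coef_poly hTdeg subn0 coefm.
have Q0 : Q.[0] = p by rewrite -hsum !hornerE T0.
have Q1 : 0 < Q.[1].
  have P1 : 0 < P.[1] by apply: (expansive_horner1_gt0 R) => //; case: hPT.
  have Pd1 : 0 < Pd.[1] by apply: (expansive_horner1_gt0 R) => //; case: hPdT.
  by rewrite !hornerE subr_gt0 (lt_trans (salem_horner1_lt0 R T hT hT1)) ?addr_gt0.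
have QN1 : Q.[-1] = T.[-1].
  rewrite hornerD hornerN hornerD (poly_over_hornerN1 P T) ?hPdeg //.
  by rewrite (poly_over_hornerN1 Pd T) ?hPddeg // addrK.
have expQ : expansive (map_poly intr Q : {poly R}).
  apply: (residues_expansive R T) => //; first by rewrite sQ hTdeg.
  move=> t Tt t1.
  have rP := residue_gt0 R P T t hT hTsimple hT1 mP eP hPT Tt t1.
  have rPd := residue_gt0 R Pd T t hT hTsimple hT1 mPd ePd hPdT Tt t1.
  rewrite /Q rmorphB rmorphD /= hornerD hornerN hornerD (rootP Tt) subr0.
  by rewrite mulrDl addr_gt0.
have MQ : mahlerZ R Q = p%:~R.
  by rewrite mahler_expansive // Q0 ger0_norm.
split=> //.
  split=> //; first exact: (expansive_prime_irreducible R Q p).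
  by rewrite MQ -[2]/(2%:R) -[p%:~R]/(p%:R) ler_nat prime_gt1.
by rewrite MQ -hP0 -hPd0 -hsum !rmorphB rmorphD.
Qed.
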